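(* $P(n) \sim Q(n) \sim \sqrt{2}\, n^{1/2}$ as $n \to \infty$. Moreover, for all integers $n > 2$, \[ \sqrt{2}n^{1/2} - 1/2 < P(n) \leq \sqrt{2}n^{1/2} + (2^{3/4} n^{1/4} + 1)\big[\log_2(\log_2(n/2)) - 1\big] + 7, \] \[ \sqrt{2}n^{1/2} + 1/2 < Q(n) \leq \sqrt{2}n^{1/2} + (2^{3/4} n^{1/4} + 1)\big[\log_2(\log_2(n/2)) - 1\big] + 7. \]
   Context: For $A \subseteq \{0,1,2,\ldots\}$, $\partial A = \{z \in A : \{z-1,z+1\} \not\subseteq A\}$, $vol(A)=\sum_{z\in A} z$, $per(A) = \sum_{z \in \partial A} z$ (both $0$ for the empty set), and $A^c = \{0,1,2,\ldots\}\setminus A$. For integers $n\ge 0$, $P(n) = \min\{per(A) : A \subseteq \{0,1,\ldots\},\ vol(A)=n\}$ and $Q(n) = \min\{per(A^c) : A \subseteq \{0,1,\ldots\},\ vol(A) = n\}$. *)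

(* Defs.v *)
From mathcomp Require Import all_boot all_order all_algebra.
From mathcomp Require Import all_classical all_reals all_analysis.

Set Implicit Arguments.
Unset Strict Implicit.
Unset Printing Implicit Defensive.

Import Order.TTheory GRing.Theory Num.Theory.
Import numFieldNormedType.Exports.

Local Open Scope classical_set_scope.
Local Open Scope ring_scope.

(* The conjunct [0 < z] encodes [z - 1 \in A] for the integer [z - 1]: since
   [-1] is never in [A], [0] is a boundary point whenever it belongs to [A]. *)
Definition boundary (A : set nat) : set nat :=
  [set z | A z /\ ~ [/\ (0 < z)%N, A z.-1 & A z.+1]].

(* Volumes and perimeters are sums in [\bar R] over possibly infinite sets;
   [vol R A] is finite only if [A] is finite. *)
Definition vol (R : realType) (A : set nat) : \bar R :=
  \esum_(z in A) (z%:R : R)%:E.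

Definition per (R : realType) (A : set nat) : \bar R :=
  \esum_(z in boundary A) (z%:R : R)%:E.

(* The least element of [S], as a real number. The default value of [xget] is
   never used for [P] and [Q] below, see [P_min], [Q_min]. *)
Definition minimum (R : realType) (S : set (\bar R)) : R :=
  fine (xget 0%E (S `&` lbound S)).

Definition P (R : realType) (n : nat) : R :=
  minimum [set per R A | A in [set A | vol R A = n%:R%:E]].

Definition Q (R : realType) (n : nat) : R :=
  minimum [set per R (~` A) | A in [set A | vol R A = n%:R%:E]].

Definition log2 (R : realType) (x : R) : R := ln x / ln 2.

Lemma esum_nat_fin (R : realType) (B : set nat) : finite_set B ->
  exists m : nat, \esum_(z in B) (z%:R : R)%:E = m%:R%:E.
Proof.
move=> Bf; exists (\sum_(z \in B) z)%N.
rewrite esum_fset//.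
by rewrite !fsbig_finite//= sumEFin natr_sum.
Qed.

Lemma esum_nat (R : realType) (B : set nat) :
  \esum_(z in B) (z%:R : R)%:E = +oo%E \/
  exists m : nat, \esum_(z in B) (z%:R : R)%:E = m%:R%:E.
Proof.
have [/(esum_nat_fin R)|Binf] := pselect (finite_set B); [by right | left].
apply: eq_infty => r.
have [k kr] : exists k : nat, r <= k%:R.
  by exists (Num.truncn `|r|).+1; rewrite (le_trans (ler_norm _))// ltW// truncnS_gt.
have [z Bz kz] : exists2 z, B z & (k <= z)%N.
  apply: contrapT => nz; apply: Binf.
  apply: (sub_finite_set _ (finite_II k)) => z Bz /=.
  by rewrite ltnNge; apply/negP => kz; apply: nz; exists z.
apply: (@le_trans _ _ (\esum_(i in [set z]) (i%:R : R)%:E)).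
  by rewrite esum_set1// lee_fin (le_trans kr)// ler_nat.
rewrite esum_mkcond [leRHS]esum_mkcond; apply: le_esum => i _ /=.
case: ifPn => [|_]; last by case: ifP.
by rewrite inE => ->; rewrite mem_set.
Qed.

Lemma minimumP (R : realType) (S : set (\bar R)) :
  (forall x, S x -> x = +oo%E \/ exists m : nat, x = m%:R%:E) ->
  (exists m : nat, S m%:R%:E) ->
  S (minimum S)%:E /\ lbound S (minimum S)%:E.
Proof.
move=> Snat [m0 Sm0].
have ex : exists m, `[< S (m%:R : R)%:E >] by exists m0; apply/asboolP.
case: (ex_minnP ex) => m /asboolP Sm mle.
have mlb : lbound S (m%:R : R)%:E.
  move=> x Sx; have [->|[k xk]] := Snat _ Sx; first exact: leey.
  by rewrite xk lee_fin ler_nat; apply: mle; apply/asboolP; rewrite -xk.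
rewrite /minimum; case: xgetP => [x _ [Sx xlb]|/(_ (m%:R : R)%:E)[]//].
suff -> : x = (m%:R : R)%:E by [].
by apply/eqP; rewrite eq_le mlb// xlb.
Qed.

Lemma vol_set1 (R : realType) (n : nat) : vol R [set n] = n%:R%:E.
Proof. by rewrite /vol esum_set1// lee_fin. Qed.

Lemma P_min (R : realType) (n : nat) :
  (exists2 A, vol R A = n%:R%:E & per R A = (P R n)%:E) /\
  (forall A, vol R A = n%:R%:E -> ((P R n)%:E <= per R A)%E).
Proof.
have [||[A vA pA] lb] :=
  @minimumP R [set per R A | A in [set A | vol R A = n%:R%:E]].
- by move=> _ [A _ <-]; exact: esum_nat.
- have [|m pm] := @esum_nat_fin R (boundary [set n]).
    by apply: (sub_finite_set _ (finite_set1 n)) => z [].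
  by exists m, [set n] => //; exact: vol_set1.
- by split=> [|B vB]; [exists A | apply: lb; exists B].
Qed.

Lemma Q_min (R : realType) (n : nat) :
  (exists2 A, vol R A = n%:R%:E & per R (~` A) = (Q R n)%:E) /\
  (forall A, vol R A = n%:R%:E -> ((Q R n)%:E <= per R (~` A))%E).
Proof.
have [||[A vA pA] lb] :=
  @minimumP R [set per R (~` A) | A in [set A | vol R A = n%:R%:E]].
- by move=> _ [A _ <-]; exact: esum_nat.
- have [|m pm] := @esum_nat_fin R (boundary (~` [set n])).
    apply: (sub_finite_set _ (finite_II n.+2)) => z [_ /= nz].
    rewrite ltnNge; apply/negP => zn; apply: nz; split=> /=.
    + exact: leq_trans zn.
    + by move=> zE; move: zn; rewrite -zE; case: (z) => // k; rewrite /= ltnn.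
    + by move=> zE; move: zn; rewrite -zE ltnNge => /negP; apply; rewrite leqW.
  by exists m, [set n] => //; exact: vol_set1.
- by split=> [|B vB]; [exists A | apply: lb; exists B].
Qed.

(* Main.v *)
Require Import Defs.
From mathcomp Require Import all_boot all_order all_algebra.
From mathcomp Require Import all_classical all_reals all_analysis.
From mathcomp Require Import zify ring lra.

Import Order.TTheory GRing.Theory Num.Theory.
Import numFieldNormedType.Exports.

Local Open Scope classical_set_scope.
Local Open Scope ring_scope.

(* If [vol B = r <= m] and [A = {0, ..., m} \ B], then
   [vol A = n := m (m + 1) / 2 - r], and the boundaries of [A] and of its
   complement lie in [{m} U bd (B^c)] and [{m + 1} U bd B].  Hence
   [P n <= m + Q r] and [Q n <= m + 1 + P r].  The least possible [m] gives
   [m < sqrt (2 n) + 1 / 2] and [r < sqrt (2 n)], so iterating bounds both by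
   [sqrt (2 n)] plus an error of order [n ^ (1 / 4)], which gives the
   asymptotics and is below the logarithmic bound as soon as
   [log2 (log2 (n / 2)) >= 3].  Smaller [n] reduce to a table of values.
   Conversely, the largest element [m] of [A] is in the boundary of [A], [m + 1]
   is in the boundary of its complement, and [n <= m (m + 1) / 2]. *)

(** * Largest elements, complements and the recursion between [P] and [Q] *)

Section recursion.
Variable R : realType.
Implicit Types (A B C : set nat) (m n r : nat).

Local Notation esumn A := (\esum_(z in A) (z%:R : R)%:E).

Let nat_ge0 (A : set nat) (z : nat) : A z -> (0 <= (z%:R : R)%:E)%E.
Proof. by move=> _; rewrite lee_fin. Qed.

Lemma esumn_sub A B : A `<=` B -> (esumn A <= esumn B)%E.
Proof.
move=> AB; rewrite (esumID A B) ?(setIidr AB); last exact: nat_ge0.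
by rewrite leeDl// esum_ge0// => i _; rewrite lee_fin.
Qed.

Lemma esumn_setU A B : (esumn (A `|` B) <= esumn A + esumn B)%E.
Proof.
rewrite (esumID A (A `|` B)); last exact: nat_ge0.
by apply: leeD; apply: esumn_sub => z; [case|case=> -[]].
Qed.

Lemma esumn1 n : esumn [set n] = n%:R%:E.
Proof. by rewrite esum_set1// lee_fin. Qed.

Lemma esumnD A B : B `<=` A ->
  esumn A = (esumn B + esumn (A `\` B))%E.
Proof.
by move=> BA; rewrite (esumID B A) ?(setIidr BA)//; exact: nat_ge0.
Qed.

Lemma esumnI m : esumn `I_m = 'C(m, 2)%:R%:E.
Proof.
rewrite -bin2_sum; elim: m => [|m IH].
  by rewrite II0 esum_set0 big_geq.
rewrite (@esumnD _ `I_m); last by move=> z /=; exact: ltnW.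
rewrite IH big_nat_recr//= natrD EFinD; congr (_ + _)%E.
rewrite -[RHS]esumn1; congr (esum _ _); apply/seteqP; split => z /=; lia.
Qed.

Lemma esumn_mem A n : A n -> (n%:R%:E <= esumn A)%E.
Proof. by move=> An; rewrite -esumn1; apply: esumn_sub => _ ->. Qed.

Lemma vol_sub_II A n : vol R A = n%:R%:E -> A `<=` `I_n.+1.
Proof. by move=> vA z /esumn_mem; rewrite -/(vol R A) vA lee_fin ler_nat. Qed.

Lemma vol_max A n : (0 < n)%N -> vol R A = n%:R%:E ->
  exists m, [/\ A m, A `<=` `I_m.+1 & (n <= 'C(m.+1, 2))%N].
Proof.
move=> n0 vA.
have [k Ak] : A !=set0.
  apply/set0P/eqP => A0; move: vA; rewrite A0 /vol esum_set0.
  by case=> /esym/eqP; rewrite pnatr_eq0; lia.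
have exA : exists k, `[< A k >] by exists k; apply/asboolP.
have leA : forall k, `[< A k >] -> (k <= n)%N.
  by move=> j /asboolP /(vol_sub_II A n vA).
case: (ex_maxnP exA leA) => m /asboolP Am mmax.
have sA : A `<=` `I_m.+1 by move=> z Az; apply: mmax; apply/asboolP.
exists m; split=> //.
by rewrite -(ler_nat R) -lee_fin -esumnI -vA; exact: esumn_sub.
Qed.

Lemma P_ge n : (0 < n)%N ->
  exists2 m, (n <= 'C(m.+1, 2))%N & (m%:R <= P R n :> R).
Proof.
move=> n0; have [[A vA pA] _] := P_min R n.
have [m [Am sA nm]] := vol_max A n n0 vA.
exists m; rewrite // -lee_fin -pA; apply: esumn_mem.
by split => // -[_ _ /sA] /=; rewrite ltnn.
Qed.

Lemma Q_ge n : (0 < n)%N ->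
  exists2 m, (n <= 'C(m.+1, 2))%N & (m.+1%:R <= Q R n :> R).
Proof.
move=> n0; have [[A vA pA] _] := Q_min R n.
have [m [Am sA nm]] := vol_max A n n0 vA.
exists m; rewrite // -lee_fin -pA; apply: esumn_mem.
by split => [/sA|[_ /(_ Am)]]//=; rewrite ltnn.
Qed.

(** No element of $B$ exceeds its volume $r$, so [r <= m] puts $B$ inside $\{0,\dots,m\}$; the
    finite volume $r$ can then be cancelled. *)
Lemma vol_compl m n r B : (n + r = 'C(m.+1, 2))%N -> (r <= m)%N ->
  vol R B = r%:R%:E -> vol R (`I_m.+1 `\` B) = n%:R%:E.
Proof.
move=> nr rm vB.
have sB : B `<=` `I_m.+1.
  by move=> z /(vol_sub_II B r vB) /=; rewrite !ltnS => /leq_trans; exact.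
have := esumnD _ _ sB; rewrite esumnI -nr -/(vol R B) vB natrD EFinD.
by move=> /(congr1 (fun x => x - r%:R%:E)%E); rewrite addeK//
  [(_%:E + _)%E]addeC addeK.
Qed.

Lemma P_le m n r : (n + r = 'C(m.+1, 2))%N -> (r <= m)%N ->
  P R n <= m%:R + Q R r.
Proof.
move=> nr rm; have [[B vB pB] _] := Q_min R r.
have [_ /(_ _ (vol_compl m n r B nr rm vB))] := P_min R n.
rewrite -lee_fin => /le_trans; apply.
rewrite EFinD -pB -esumn1; apply: le_trans (esumn_setU _ _).
apply: esumn_sub => z [[/= zm Bz] nb].
have [->|zNm] := eqVneq z m; [by left|right].
split=> // -[z0 Bp Bs]; apply: nb; split => //; split => //=; lia.
Qed.

Lemma Q_le m n r : (n + r = 'C(m.+1, 2))%N -> (r <= m)%N ->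
  Q R n <= m.+1%:R + P R r.
Proof.
move=> nr rm; have [[B vB pB] _] := P_min R r.
have [_ /(_ _ (vol_compl m n r B nr rm vB))] := Q_min R n.
rewrite -lee_fin => /le_trans; apply.
rewrite EFinD -pB -esumn1; apply: le_trans (esumn_setU _ _).
apply: esumn_sub => z [/= Az nb].
have [->|zNm] := eqVneq z m.+1; [by left|right].
have [zm|zm] := ltnP z m.+1; last first.
  (* Beyond $m+1$ both neighbours of $z$ also exceed $m$, so $z$ is interior to the complement. *)
  exfalso; apply: nb; split=> [|[/= + _]|[/= + _]]; lia.
have Bz : B z by apply: contrapT => nB; exact: Az.
by split=> // -[z0 Bp Bs]; apply: nb; split => // -[].
Qed.

Lemma P_le_self n : P R n <= n%:R.
Proof.
have [_ /(_ _ (vol_set1 R n))] := P_min R n.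
rewrite -lee_fin => /le_trans; apply; rewrite -esumn1.
by apply: esumn_sub => z [].
Qed.

Lemma PQ0 : P R 0 = 0 /\ Q R 0 = 0.
Proof.
have P0 : P R 0 <= 0 by rewrite (le_trans (P_le_self 0)).
have v0 : vol R set0 = 0%:R%:E by rewrite /vol esum_set0.
have P0' : 0 <= P R 0.
  have [[A vA pA] _] := P_min R 0.
  by rewrite -lee_fin -pA esum_ge0// => i _; rewrite lee_fin.
have Q0' : 0 <= Q R 0.
  have [[A vA pA] _] := Q_min R 0.
  by rewrite -lee_fin -pA esum_ge0// => i _; rewrite lee_fin.
have Q0 : Q R 0 <= 0.
  have [_ /(_ _ v0)] := Q_min R 0.
  rewrite -lee_fin => /le_trans; apply; rewrite -(esumn1 0).
  (* The complement of the empty set has $0$ as its only boundary point, of weight $0$. *)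
  by apply: esumn_sub => -[|z] [_ nb] //; case: nb; split; exact: id.
by split; lra.
Qed.
End recursion.

(** * Computable upper bounds from the recursion *)

Definition tri_root (n : nat) : nat :=
  find (fun m => n <= 'C(m.+1, 2))%N (iota 0 n.+1).

(* Upper bounds for [(P n, Q n)] when [n < k]; [k] is only fuel.  The [minn n]
   accounts for the competitor [A = {n}], which matters at [n = 2, 4]. *)
Fixpoint greedy (k n : nat) : nat * nat :=
  if k isn't k'.+1 then (0, 0)%N else
  if n is 0 then (0, 0)%N else
  let m := tri_root n in
  let pq := greedy k' ('C(m.+1, 2) - n)%N in
  (minn n (m + pq.2), m.+1 + pq.1)%N.

(** The search succeeds because $n \le n(n+1)/2$. Minimality of the root $m+1$ gives $m \le m(m+1)/2
    < n$, and consecutive triangular numbers differ by $m+1$, whence $r \le m$. *)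
Lemma tri_rootP n : (0 < n)%N ->
  exists m r, [/\ tri_root n = m.+1, (n + r = 'C(m.+2, 2))%N, (r <= m)%N &
    (m < n)%N].
Proof.
move=> n0.
have hs : has (fun m => n <= 'C(m.+1, 2))%N (iota 0 n.+1).
  apply/hasP; exists n; first by rewrite mem_iota; lia.
  by rewrite binS bin1 leq_addl.
have := nth_find 0%N hs.
have := @before_find _ 0%N (fun m => n <= 'C(m.+1, 2))%N (iota 0 n.+1).
move: hs; rewrite has_find size_iota -/(tri_root n).
case: (tri_root n) => [_ _|m ltmn /(_ m)].
  by rewrite nth_iota// add0n bin_small// leqn0 => /eqP n00; rewrite n00 in n0.
rewrite (nth_iota _ _ ltmn) (nth_iota _ _ (ltnW ltmn)).
move=> /(_ (ltnSn m)) /negbT; rewrite -ltnNge !add0n => lt_n le_n.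
exists m, ('C(m.+2, 2) - n)%N; split; [by [] | exact: subnKC | |].
  by rewrite leq_subLR [X in (X <= _)%N]binS bin1 -addSnnS leq_add2r.
by rewrite (leq_ltn_trans _ lt_n)// binS bin1 leq_addl.
Qed.

Section bounds.
Variable R : realType.
Implicit Types (n m r k : nat).

Lemma greedyP k n : (n < k)%N ->
  P R n <= (greedy k n).1%:R /\ Q R n <= (greedy k n).2%:R.
Proof.
elim: k n => // k IH [|n nk]; first by have [-> ->] := PQ0 R.
have [m [r [/= -> nr rm mn]]] := tri_rootP n.+1 isT.
rewrite -nr addKn.
have /IH[Pr Qr] : (r < k)%N by lia.
rewrite !natrD; split.
  rewrite /minn; case: ifP => _; first exact: P_le_self.
  by rewrite natrD (le_trans (P_le R _ _ _ nr _)) ?lerD2l// leqW.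
by rewrite (le_trans (Q_le R _ _ _ nr _)) ?lerD2l// leqW.
Qed.

(** The recursion exchanges [P] and [Q]; their maximum obeys a recursion of its own. *)
Definition PQmax n : R := Num.max (P R n) (Q R n).

Lemma PQmax_greedy k n : (n < k)%N ->
  PQmax n <= (maxn (greedy k n).1 (greedy k n).2)%:R.
Proof.
move=> nk; have [Pn Qn] := greedyP k n nk.
by rewrite /PQmax natr_max ge_max !le_max Pn Qn orbT.
Qed.

(** With root $m+1$ and $r \le m$, $2n = (m+2)(m+1) - 2r \ge m^2+m+2 > (m+1/2)^2$. The costlier step
    adds $m+2 \le \sqrt{2n} + 3/2$. *)
Lemma PQmax_recur n : (0 < n)%N -> exists r, [/\ (r < n)%N,
  r%:R + 1 / 2 <= Num.sqrt (2 * n%:R) :> R &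
  PQmax n <= Num.sqrt (2 * n%:R) + 3 / 2 + PQmax r].
Proof.
move=> n0; have [m [r [_ nr rm mn]]] := tri_rootP n n0.
exists r.
have n2 : (2 * (n + r) = m.+2 * m.+1)%N.
  by rewrite nr; have := mul_bin_diag m.+2 1; rewrite bin1 /=; lia.
have y : m%:R + 1 / 2 <= Num.sqrt (2 * n%:R) :> R.
  have : 2 * (n%:R + r%:R) = (m%:R + 2) * (m%:R + 1) :> R.
    have -> : m%:R + 2 = m.+2%:R :> R by rewrite -natrD addn2.
    by rewrite natr1 -natrD -!natrM n2.
  have : r%:R <= m%:R :> R by rewrite ler_nat.
  have : 0 <= m%:R :> R by [].
  move=> m0 lerm n2R.
  rewrite -[leLHS]ger0_norm ?addr_ge0// -sqrtr_sqr ler_wsqrtr// expr2.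
  nra.
have ler : r%:R <= m%:R :> R by rewrite ler_nat.
split; [exact: leq_ltn_trans mn | lra |].
have Pn := P_le R m.+1 n r nr (leqW rm).
have Qn := Q_le R m.+1 n r nr (leqW rm).
have Pr : P R r <= PQmax r by rewrite /PQmax le_max lexx.
have Qr : Q R r <= PQmax r by rewrite /PQmax le_max lexx orbT.
move: Pn Qn; rewrite -(natr1 m.+1) -(natr1 m) => Pn Qn.
by rewrite {1}/PQmax ge_max; apply/andP; split; lra.
Qed.

(* The induction step needs [3 / 2 + 2 sqrt (2 y - 1) <= y] for
   [y = sqrt (2 n)], which holds from [n = 58] on. *)
Lemma PQmax_le_sqrt n : PQmax n <= 2 * Num.sqrt (2 * n%:R) + 15 / 2.
Proof.
elim/ltn_ind: n => n IH; have [n58|n58] := ltnP n 58.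
  pose g i := maxn (greedy 58 i).1 (greedy 58 i).2.
  (* This is $2g - 15 \le 4\sqrt{2i}$ squared; truncated subtraction covers $2g < 15$. *)
  have : all (fun i => (2 * g i - 15) ^ 2 <= 32 * i)%N (iota 0 58)
    by vm_compute.
  move=> /allP/(_ n); rewrite mem_iota n58 => /(_ isT).
  rewrite -(ler_nat R) natrX natrM => gn.
  have := PQmax_greedy 58 n n58; rewrite -/(g n) => PQn.
  have y0 : 0 <= Num.sqrt (2 * n%:R) :> R by exact: sqrtr_ge0.
  have y2 : Num.sqrt (2 * n%:R) ^+ 2 = 2 * n%:R :> R
    by rewrite sqr_sqrtr// mulr_ge0.
  have : 2 * (g n)%:R - 15 <= (2 * g n - 15)%:R :> R.
    by rewrite lerBlDr -natrM -natrD ler_nat; lia.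
  nra.
have [r [rn ry PQn]] := PQmax_recur n (leq_trans (isT : (0 < 58)%N) n58).
have := IH r rn; move: ry PQn; set y := Num.sqrt _; set t := Num.sqrt _.
move=> ry PQn PQr.
have y0 : 0 <= y by exact: sqrtr_ge0.
have t0 : 0 <= t by exact: sqrtr_ge0.
have y2 : y ^+ 2 = 2 * n%:R by rewrite sqr_sqrtr// mulr_ge0.
have t2 : t ^+ 2 = 2 * r%:R by rewrite sqr_sqrtr// mulr_ge0.
have n58R : 58 <= n%:R :> R by rewrite ler_nat.
(* As $t^2 \le 2y-1$, the goal reduces to $y^2 - 11y + 25/4 \ge 0$, whose larger root is just below
   $10.4$. *)
have y10 : 107 / 10 <= y by nra.
suff : 2 * t <= y - 3 / 2 by lra.
have : 4 * t ^+ 2 <= (y - 3 / 2) ^+ 2 by rewrite t2; nra.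
nra.
Qed.

End bounds.

(** * Estimates for logarithms, powers and square roots *)

Section logarithms.
Variable R : realType.

Lemma log2_ge (x : R) (a b : nat) :
  0 < x -> (0 < b)%N -> 2 ^+ a <= x ^+ b -> a%:R / b%:R <= log2 x.
Proof.
move=> x0 b0 ab.
have ln2 : 0 < ln 2 :> R by rewrite ln_gt0// ltr1n.
have b0R : 0 < b%:R :> R by rewrite ltr0n.
rewrite /log2 ler_pdivlMr// mulrAC ler_pdivrMr//.
move: ab; rewrite -ler_ln ?posrE ?exprn_gt0// !lnXn//.
by rewrite -[leLHS]mulr_natl -[leRHS]mulr_natr.
Qed.

(** Reduces a rational lower bound on the double logarithm to an inequality between natural numbers,
    decided by computation. *)
Lemma loglog2_ge (k a b : nat) (x : R) : (0 < k)%N -> (0 < b)%N ->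
  (2 ^ a <= k ^ b)%N -> 2 ^+ k <= x -> a%:R / b%:R <= log2 (log2 x).
Proof.
move=> k0 b0 ab kx.
have x0 : 0 < x by rewrite (lt_le_trans _ kx)// exprn_gt0.
have := @log2_ge x k 1 x0 isT; rewrite expr1 divr1 => /(_ kx) kl.
apply: log2_ge => //; first by rewrite (lt_le_trans _ kl)// ltr0n.
rewrite (@le_trans _ _ (k%:R ^+ b))//; first by rewrite -!natrX ler_nat.
by rewrite lerXn2r// nnegrE ?(le_trans _ kl).
Qed.

(** The case $n = 3$, where $n/2 < 2$ is too small for [loglog2_ge]; it rests on $2 \le (3/2)^2$. *)
Lemma loglog2_ge_N1 : -1 <= log2 (log2 (3 / 2 : R)).
Proof.
have := @log2_ge (3 / 2) 1 2; move=> /(_ _ isT) h.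
have {h} h : 1 / 2 <= log2 (3 / 2) :> R by apply: h; lra.
have ln2 : 0 < ln 2 :> R by rewrite ln_gt0// ltr1n.
rewrite {1}/log2 ler_pdivlMr// mulN1r -lnV ?posrE// ler_ln ?posrE; lra.
Qed.

Lemma sqrt2_powR12 (n : nat) :
  Num.sqrt 2 * n%:R `^ (1 / 2) = Num.sqrt (2 * n%:R) :> R.
Proof. by rewrite mul1r powR12_sqrt// sqrtrM. Qed.

(** With $y = \sqrt{2n}$ and $w$ the fourth-root term, $w^2 = 2y$ makes later estimates polynomial
    in $y$ and $w$. *)
Lemma sqr_powR34 (n : nat) :
  (2 `^ (3 / 4) * n%:R `^ (1 / 4)) ^+ 2 = 2 * Num.sqrt (2 * n%:R) :> R.
Proof.
rewrite exprMn -!powR_mulrn ?powR_ge0// -!powRrM.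
have -> : 3 / 4 * 2%:R = 1 + 2^-1 :> R by lra.
have -> : 1 / 4 * 2%:R = 2^-1 :> R by lra.
by rewrite powRD ?pnatr_eq0 ?implybT// powRr1// !powR12_sqrt// sqrtrM// mulrA.
Qed.

(** Indeed $2n \le m(m+1) < (m+1/2)^2$. *)
Lemma sqrt_lt_bin (n m : nat) : (n <= 'C(m.+1, 2))%N ->
  Num.sqrt (2 * n%:R) < m%:R + 1 / 2 :> R.
Proof.
move=> nm; have n2 : (2 * n <= m.+1 * m)%N.
  by have := mul_bin_diag m.+1 1; rewrite bin1 /= => ->;
    rewrite leq_mul2l nm orbT.
have m0 : 0 <= m%:R + 1 / 2 :> R by rewrite addr_ge0.
rewrite -[ltRHS]ger0_norm// -sqrtr_sqr ltr_sqrt; last first.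
  by rewrite exprn_gt0// ltr_wpDl.
apply: (@le_lt_trans _ _ ((m%:R + 1) * m%:R)).
  by rewrite natr1 -!natrM ler_nat.
rewrite expr2; lra.
Qed.

End logarithms.

(** * Asymptotic equivalence and the explicit bounds *)

Section asymptotics.
Variable R : realType.
Implicit Types n : nat.

Lemma P_gt n : (0 < n)%N -> Num.sqrt (2 * n%:R) - 1 / 2 < P R n.
Proof.
by move=> /(P_ge R)[m /(sqrt_lt_bin R) nm mP]; lra.
Qed.

Lemma Q_gt n : (0 < n)%N -> Num.sqrt (2 * n%:R) + 1 / 2 < Q R n.
Proof.
by move=> /(Q_ge R)[m /(sqrt_lt_bin R) nm]; rewrite -natr1 => mQ; lra.
Qed.

(** One more recursion step: [PQmax_le_sqrt] is applied to the remainder $r$, where $2r \le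
    2\sqrt{2n} = w^2$, and $9 = 3/2 + 15/2$. *)
Lemma PQmax_le_sqrtD (n : nat) (w : R) : (0 < n)%N -> 0 <= w ->
  w ^+ 2 = 2 * Num.sqrt (2 * n%:R) ->
  PQmax R n <= Num.sqrt (2 * n%:R) + 2 * w + 9.
Proof.
move=> n0 w0 w2; have [r [_ ry PQn]] := PQmax_recur R n n0.
have PQr := PQmax_le_sqrt R r.
suff : Num.sqrt (2 * r%:R) <= w by lra.
rewrite -[leRHS]ger0_norm// -sqrtr_sqr ler_wsqrtr// w2; lra.
Qed.

Lemma equiv_sqrt (f : nat -> R) :
  (forall n, (0 < n)%N -> Num.sqrt (2 * n%:R) - 1 / 2 < f n) ->
  (forall n, f n <= PQmax R n) ->
  (f : nat -> R^o) ~_\oo (fun n => Num.sqrt 2 * n%:R `^ (1 / 2) : R^o).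
Proof.
move=> fgt fle; apply/eqaddoP => e e0; near=> n.
rewrite /= !fctE sqrt2_powR12; set y := Num.sqrt _.
have n0 : (0 < n)%N by near: n; exact: nbhs_infty_gt.
have y2 : y ^+ 2 = 2 * n%:R by rewrite sqr_sqrtr// mulr_ge0.
have y0 : 0 <= y by exact: sqrtr_ge0.
pose w : R := 2 `^ (3 / 4) * n%:R `^ (1 / 4).
have w0 : 0 <= w by rewrite mulr_ge0// powR_ge0.
have w2 : w ^+ 2 = 2 * y by exact: sqr_powR34.
have := PQmax_le_sqrtD n w n0 w0 w2; rewrite -/y.
have := fgt n n0; have := fle n; rewrite -/y => f1 f2 f3.
(* The error is at most $2w + 9$. The first term of [K] gives $9 \le ey/2$; the second gives $ew \ge
   8$, hence $2w \le ew^2/4 = ey/2$. *)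
pose K := 18 / e + 32 / e ^+ 2.
have yK : K <= y.
  have K0 : 0 <= K by rewrite addr_ge0// divr_ge0// ?sqr_ge0// ltW.
  rewrite -[leLHS]ger0_norm// -sqrtr_sqr ler_wsqrtr//.
  rewrite (@le_trans _ _ n%:R)//; last by rewrite ler_peMl// ler1n.
  by near: n; exact: nbhs_infty_ger.
have [ey9 ew8] : 18 <= e * y /\ 8 <= e * w.
  have e1 : 18 / e <= y by rewrite (le_trans _ yK)// lerDl divr_ge0// sqr_ge0.
  have e2 : 32 / e ^+ 2 <= y by rewrite (le_trans _ yK)// lerDr divr_ge0// ltW.
  move: e1 e2; rewrite !ler_pdivrMr ?exprn_gt0// => e1 e2.
  have ew0 : 0 <= e * w by rewrite mulr_ge0// ltW.
  have : 64 <= (e * w) ^+ 2 by rewrite exprMn w2; lra.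
  split; [lra | nra].
have : 2 * w <= e * y / 2.
  have -> : y = w ^+ 2 / 2 by lra.
  nra.
rewrite (ger0_norm y0) ler_norml => ?.
apply/andP; split; lra.
Unshelve. all: by end_near. Qed.

Lemma PQmax_le_loglog n : (2 < n)%N ->
  PQmax R n <= Num.sqrt (2 * n%:R)
    + (2 `^ (3 / 4) * n%:R `^ (1 / 4) + 1) * (log2 (log2 (n%:R / 2)) - 1) + 7.
Proof.
move=> n2; have := sqr_powR34 R n.
have : 0 <= 2 `^ (3 / 4) * n%:R `^ (1 / 4) :> R by rewrite mulr_ge0// powR_ge0.
have : Num.sqrt (2 * n%:R) ^+ 2 = 2 * n%:R :> R by rewrite sqr_sqrtr// mulr_ge0.
have : 0 <= Num.sqrt (2 * n%:R) :> R by exact: sqrtr_ge0.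
have := PQmax_le_sqrtD n (2 `^ (3 / 4) * n%:R `^ (1 / 4)) (ltnW (ltnW n2)).
have := PQmax_recur R n (ltnW (ltnW n2)).
set y := Num.sqrt _; set w := _ `^ _ * _; set l := log2 _.
move=> [r [rn ry PQn]] PQ9 y0 y2 w0 w2; have {PQ9} PQ9 := PQ9 w0 w2.
(* With [y = sqrt (2 n)] and [w ^ 2 = 2 y], it suffices to bound [PQmax n] by
   the right-hand side for a rational [l0 <= l] fixed on each range of [n]. *)
suff [l0 l0l U] : exists2 l0, l0 <= l & PQmax R n <= y + (w + 1) * (l0 - 1) + 7.
  rewrite (le_trans U)// lerD2r lerD2l ler_wpM2l ?addr_ge0//; lra.
have tbl k c :
    all (fun i => maxn (greedy k i).1 (greedy k i).2 <= c)%N (iota 0 k) ->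
    forall i, (i < k)%N -> PQmax R i <= c%:R.
  move=> /allP h i ik; rewrite (le_trans (PQmax_greedy R k i ik))// ler_nat.
  by apply: h; rewrite mem_iota.
(* The exponent $k+1$ absorbs the division of $n$ by $2$, and $2^a \le k^b$ says $a/b \le \log_2
   k$. *)
have loglog k a b : (0 < k)%N -> (0 < b)%N -> (2 ^ a <= k ^ b)%N ->
    (2 ^ k.+1 <= n)%N -> a%:R / b%:R <= l.
  move=> k0 b0 ab kn; apply: loglog2_ge ab _ => //.
  by rewrite ler_pdivlMr// -exprSr -natrX ler_nat.
have ny (k : nat) : (k <= n)%N -> 2 * k%:R <= y ^+ 2.
  by move=> kn; rewrite y2 ler_pM2l// ler_nat.
(* A large remainder forces a large $y$, hence a large $w$, which pays for the larger table
   values. *)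
have rle (k : nat) : (k < r)%N -> k%:R + 3 / 2 <= y.
  by rewrite -(ler_nat R) -natr1 => kr; lra.
have [n512|n512] := leqP 512 n.
  (* For $l_0 = 3$ the right-hand side is $y + 2w + 9$, the bound of [PQmax_le_sqrtD]. *)
  exists 3; last lra.
  by have := loglog 8 3 1 isT isT isT n512; rewrite divr1.
have [n128|n128] := leqP 128 n.
  exists (5 / 2); first exact: (loglog 6 5 2 isT isT isT n128).
  have rlt : (r < 32)%N.
    rewrite ltnNge; apply/negP => /rle.
    have : n%:R <= 511 :> R by rewrite ler_nat.
    nra.
  have [r29|r29] := ltnP r 29.
    have Tr := tbl 29 15 isT r r29.
    have y16 : 16 <= y by have := ny _ n128; nra.
    have w5 : 28 / 5 <= w by nra.
    lra.
  have Tr := tbl 32 16 isT r rlt.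
  have w7 : 7 <= w by have := rle _ r29; nra.
  lra.
have [n32|n32] := leqP 32 n.
  exists 2; first by have := loglog 4 2 1 isT isT isT n32; rewrite divr1.
  have rlt : (r < 16)%N.
    rewrite ltnNge; apply/negP => /rle.
    have : n%:R <= 127 :> R by rewrite ler_nat.
    nra.
  have [r11|r11] := ltnP r 11.
    have Tr := tbl 11 9 isT r r11.
    have y8 : 8 <= y by have := ny _ n32; nra.
    have w4 : 4 <= w by nra.
    lra.
  have Tr := tbl 16 11 isT r rlt.
  have w4 : 9 / 2 <= w by have := rle _ r11; nra.
  lra.
have [n16|n16] := leqP 16 n.
  exists (3 / 2); first exact: (loglog 3 3 2 isT isT isT n16).
  have rlt : (r < 8)%N.
    rewrite ltnNge; apply/negP => /rle.
    have : n%:R <= 31 :> R by rewrite ler_nat.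
    nra.
  have Tr := tbl 8 7 isT r rlt.
  have y4 : 4 <= y by have := ny _ n16; nra.
  have w2' : 2 <= w by nra.
  lra.
have [n8|n8] := leqP 8 n.
  (* The $w$ term vanishes, so a table for $n$ itself and $y \ge 4$ suffice. *)
  exists 1; first by have := loglog 2 1 1 isT isT isT n8; rewrite divr1.
  have Tn := tbl 16 11 isT n n16.
  have y4 : 4 <= y by have := ny _ n8; nra.
  lra.
have [n4|n4] := leqP 4 n.
  exists 0; first by have := loglog 1 0 1 isT isT isT n4; rewrite mul0r.
  have [n7|n7] := ltnP n 7.
    have Tn := tbl 7 6 isT n n7.
    have y2' : 2 <= y by have := ny _ n4; nra.
    have w2' : 2 <= w by nra.
    nra.
  have Tn := tbl 8 7 isT n n8.
  (* For $n = 7$ the claim needs $y - w \ge 1$, while $y - w \approx 1.006$; hence the sharp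
     constants. *)
  have y3 : 187 / 50 <= y by have := ny _ n7; nra.
  have w3 : 2733 / 1000 <= w by nra.
  nra.
have n3 : n = 3%N by lia.
exists (-1); first by rewrite /l n3; exact: loglog2_ge_N1.
have Tn : PQmax R n <= 3%:R by rewrite n3; exact: (PQmax_greedy R 4 3 isT).
(* The claim $3 \le y - 2w + 5$ is exactly $(w-2)^2 \ge 0$, as $w^2 = 2y$. *)
have w4 : 0 <= (w - 2) ^+ 2 := sqr_ge0 _.
have e : (w - 2) ^+ 2 = 2 * y - 4 * w + 4 by rewrite -w2; ring.
lra.
Qed.

End asymptotics.

Theorem theorem12 (R : realType) :
  [/\ (P R : nat -> R^o) ~_\oo (Q R : nat -> R^o),
      (Q R : nat -> R^o) ~_\oo
        (fun n : nat => Num.sqrt 2 * n%:R `^ (1 / 2) : R^o) &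
      forall n : nat, (2 < n)%N ->
        let upper : R :=
          Num.sqrt 2 * n%:R `^ (1 / 2)
          + (2 `^ (3 / 4) * n%:R `^ (1 / 4) + 1)
            * (log2 (log2 (n%:R / 2)) - 1) + 7 in
        (Num.sqrt 2 * n%:R `^ (1 / 2) - 1 / 2 < P R n <= upper) /\
        (Num.sqrt 2 * n%:R `^ (1 / 2) + 1 / 2 < Q R n <= upper)].
Proof.
have P_le_max n : P R n <= PQmax R n by rewrite /PQmax le_max lexx.
have Q_le_max n : Q R n <= PQmax R n by rewrite /PQmax le_max lexx orbT.
have P_equiv := equiv_sqrt R (P R) (P_gt R) P_le_max.
have Q_equiv : (Q R : nat -> R^o) ~_\oo
    (fun n => Num.sqrt 2 * n%:R `^ (1 / 2) : R^o).
  by apply: equiv_sqrt => // n n0; have := Q_gt R n n0; lra.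
split=> // [|n n2].
  by apply: equiv_trans P_equiv _; exact: equiv_sym.
have n0 : (0 < n)%N := ltnW (ltnW n2).
rewrite sqrt2_powR12 /=; split; apply/andP; split.
- exact: P_gt.
- exact: le_trans (P_le_max n) (PQmax_le_loglog R n n2).
- exact: Q_gt.
- exact: le_trans (Q_le_max n) (PQmax_le_loglog R n n2).
Qed.
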